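(* For $n\ge2$ the rescaled $(-1)$-splitting measure $n!\,\nu_{n,-1}^{\ast}$ is the character of a representation $\tilde\rho_n$ of $S_n$. It is realized as a permutation representation, given as the induced representation $\mathrm{Ind}_{C_2}^{S_n}(\chi_{\mathrm{triv}})$, where $C_2=\{e,(12)\}$ is the group generated by a $2$-cycle and $\chi_{\mathrm{triv}}$ is its trivial representation.
   Context: Representations are over $\mathbb{C}$. For a partition $\lambda\vdash n$, $m_j(\lambda)$ is the number of parts equal to $j$, and $C_\lambda\subset S_n$ is the conjugacy class of permutations of cycle type $\lambda$. The $m$-th necklace polynomial is $M_m(X)=\frac1m\sum_{d\mid m}\mu(d)X^{m/d}$. For $z\in\mathbb{C}\setminus\{0,1\}$ the $z$-splitting measure on $S_n$ is defined on conjugacy classes by $$\nu_{n,z}^{\ast}(C_\lambda)=\frac{1}{z^{n-1}(z-1)}\prod_{j=1}^n\binom{M_j(z)}{m_j(\lambda)},\qquad \binom{t}{k}=\frac{t(t-1)\cdots(t-k+1)}{k!},$$ and on elements by $\nu_{n,z}^{\ast}(g)=\nu_{n,z}^{\ast}(C_\lambda)/|C_\lambda|$ for $g\in C_\lambda$. The class function in the claim is $g\mapsto n!\,\nu_{n,-1}^{\ast}(g)$. *)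

(* Defs.v *)
From HB Require Import structures.
From mathcomp Require Import all_boot all_order all_algebra all_fingroup.
From mathcomp Require Import mxrepresentation.
From mathcomp Require Import complex reals.

Set Implicit Arguments.
Unset Strict Implicit.
Unset Printing Implicit Defensive.

Import Order.TTheory GRing.Theory Num.Theory.
Local Open Scope ring_scope.

(* Partitions of n are weakly decreasing sequences of positive integers, so
   that m_j(lambda) is count_mem j lambda. Fixed points of g are orbits in
   porbits g, hence contribute the parts equal to 1. *)
Definition cycle_type (n : nat) (g : 'S_n) : seq nat :=
  sort geq [seq #|pred_of_set c| | c <- enum (porbits g)].

Definition cycle_class (n : nat) (la : seq nat) : {set 'S_n} :=
  [set g | cycle_type g == la].

Definition moebius (d : nat) : int :=
  if all (fun p => logn p d == 1%N) (primes d) then (-1) ^+ size (primes d)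
  else 0.

Definition necklace (F : numFieldType) (m : nat) : {poly F} :=
  m%:R^-1 *: \sum_(d <- divisors m) (moebius d)%:~R *: 'X^(m %/ d).

Definition gbinom (F : numFieldType) (t : F) (k : nat) : F :=
  (\prod_(i < k) (t - i%:R)) / (k`!)%:R.

(* The z-splitting measure, on conjugacy classes and on elements; it is
   meaningful for z different from 0 and 1. *)
Definition splitting_measure_class (F : numFieldType) (n : nat) (z : F)
    (la : seq nat) : F :=
  (z ^+ n.-1 * (z - 1))^-1 *
  \prod_(1 <= j < n.+1) gbinom (necklace F j).[z] (count_mem j la).

Definition splitting_measure (F : numFieldType) (n : nat) (z : F) (g : 'S_n)
    : F :=
  splitting_measure_class n z (cycle_type g)
    / #|cycle_class n (cycle_type g)|%:R.

Lemma triv_mx_repr (F : fieldType) (gT : finGroupType) (G : {group gT}) :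
  mx_repr G (fun _ : gT => 1%:M : 'M[F]_1).
Proof. by split=> // x y _ _; rewrite mulmx1. Qed.

Definition triv_repr (F : fieldType) (gT : finGroupType) (G : {group gT}) :
  mx_representation F G 1 := MxRepresentation (triv_mx_repr F G).

Definition is_permutation_repr (F : fieldType) (gT : finGroupType)
    (G : {group gT}) (N : nat) (rG : mx_representation F G N) : Prop :=
  {in G, forall g, is_perm_mx (rG g)}.

(* rG is the representation of G induced by the representation rH of the
   subgroup H: its space V = F^N contains (as the row space of W) a copy of
   the H-module affording rH, and V is the direct sum of the translates of
   this subspace indexed by the cosets of H. Representations act on row vectors
   from the right, so the translate W x depends only on the right coset H x. *)
Definition is_induced_repr (F : fieldType) (gT : finGroupType)
    (G H : {group gT}) (N d : nat) (rG : mx_representation F G N)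
    (rH : mx_representation F H d) : Prop :=
  H \subset G /\
  exists W : 'M[F]_(d, N),
    [/\ row_free W,
        {in H, forall h, W *m rG h = rH h *m W},
        mxdirect (\sum_(A in rcosets H G) <<W *m rG (repr A)>>)%MS &
        row_full (\sum_(A in rcosets H G) <<W *m rG (repr A)>>)%MS].

(* The symmetric group acts on {0, ..., n-1}, so the transposition (1 2) is
   written here as the transposition of 0 and 1. *)
Definition transp_group (n : nat) (hn : (2 <= n)%N) : {group 'S_n} :=
  <[tperm (Ordinal (ltnW hn)) (Ordinal hn)]>%G.

(* Main.v *)
Require Import Defs.
From mathcomp Require Import all_boot all_order all_algebra all_fingroup.
From mathcomp Require Import mxrepresentation.
From mathcomp Require Import complex reals.
From mathcomp Require Import cyclic zify ring.

(** At [z = -1] the splitting measure lives on two conjugacy classes only.  The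
    necklace polynomials take the values [M_1(-1) = -1], [M_2(-1) = 1] and
    [M_j(-1) = 0] for [j >= 3] ([necklace_N1_eq0]: pairing the divisors [d] and
    [p d] cancels the Moebius sum for a suitable prime [p]).  Since
    [binom(-1, k) = (-1)^k], [binom(1, k) = 0] for [k >= 2] and
    [binom(0, k) = 0] for [k >= 1], the product over the cycle lengths survives
    exactly for permutations with at most one 2-cycle and nothing longer, where
    it is [(-1)^n].  That condition says that the number of cycles is at least
    [n - 1], which is the form [n <= #|porbits g|.+1] used throughout: it
    interacts well with products by transpositions, and it characterizes the
    identity and the transpositions ([identity_or_tpermP]).  Hence
    [n! nu(g) = n! / (2 |C(g)|)] if [g] is the identity or a transposition, and
    [0] otherwise, with [C(g)] the conjugacy class of [g].

    On the other side stands the permutation representation of a group [G] on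
    the right cosets of [H], which is the induction of the trivial
    representation of [H] ([coset_repr_is_induced]).  Its character counts fixed
    cosets, and double counting the pairs [(x, y)] with [y] conjugate to [g] and
    [x y x^-1] in [H] gives
    [|H| |g^G| chi(g) = |G| |H :&: g^G|] ([mxtrace_coset_repr_class]).
    For [H] generated by a transposition, [H :&: g^G] is a singleton when [g] is
    the identity or a transposition and is empty otherwise
    ([card_cycle_tperm_class]), so the two class functions agree. *)

Set Implicit Arguments.
Unset Strict Implicit.
Unset Printing Implicit Defensive.

Import Order.TTheory GRing.Theory Num.Theory.
Local Open Scope ring_scope.

(** * Necklace polynomials at -1 *)

Lemma moebius_sqr_dvd (p d : nat) :
  (0 < d)%N -> prime p -> (p ^ 2 %| d)%N -> moebius d = 0.
Proof.
move=> d_gt0 p_pr p2d; rewrite /moebius; case: allP => // /(_ p).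
rewrite mem_primes p_pr d_gt0 (dvdn_trans (dvdn_exp _ (dvdnn p)) p2d) //=.
by move/(_ isT)/eqP=> lg1; move: p2d; rewrite pfactor_dvdn // lg1.
Qed.

Lemma moebius_prime_mul (p e : nat) :
  (0 < e)%N -> prime p -> ~~ (p %| e)%N -> moebius (p * e) = - moebius e.
Proof.
move=> e_gt0 p_pr pNe; have p_gt0 := prime_gt0 p_pr.
have eq_pr : perm_eq (primes (p * e)) (p :: primes e).
  apply: uniq_perm; rewrite /= ?primes_uniq ?mem_primes ?(negPf pNe) ?andbF //.
  by move=> q; rewrite primesM // primes_prime // !inE.
rewrite /moebius (perm_size eq_pr) (perm_all _ eq_pr) /=.
rewrite lognM // logn_prime // eqxx lognE (negPf pNe) !andbF addn0 eqxx /=.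
set b := all _ _; set b' := all _ _; have -> : b = b'.
  apply: eq_in_all => q; rewrite mem_primes => /and3P[q_pr _ qe].
  rewrite lognM // logn_prime //; have [qp | //] := eqVneq q p.
  by rewrite -qp qe in pNe.
by case: b'; rewrite ?oppr0 // exprS mulN1r.
Qed.

(** Only divisors [d] with [p ^ 2] not dividing [d] contribute.  Those come in
    pairs [k], [p * k] with [p] prime to [k], on which [moebius] takes opposite
    values; so the sum vanishes as soon as [f] does not distinguish the two
    cofactors. *)
Lemma sum_moebius_pairing (R : pzRingType) (f : nat -> R) (p m : nat) :
    (0 < m)%N -> prime p -> (p %| m)%N ->
    (forall k, (p * k %| m)%N -> ~~ (p %| k)%N ->
       f (m %/ k)%N = f (m %/ (p * k))%N) ->
  \sum_(d <- divisors m) (moebius d)%:~R * f (m %/ d)%N = 0.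
Proof.
move=> m_gt0 p_pr pm fE; have p_gt0 := prime_gt0 p_pr.
rewrite (bigID (fun d => p %| d)%N) /=.
rewrite (bigID (fun d => p ^ 2 %| d)%N) /= big_seq_cond big1 ?add0r; last first.
  move=> d; rewrite -dvdn_divisors // => /and3P[dm _ p2d].
  by rewrite (moebius_sqr_dvd (dvdn_gt0 m_gt0 dm) p_pr) ?mul0r.
rewrite -big_filter -[X in _ + X]big_filter.
set s := filter _ _; set t := filter _ _.
have -> : \sum_(d <- s) (moebius d)%:~R * f (m %/ d)%N =
          \sum_(d <- map (muln p) t) (moebius d)%:~R * f (m %/ d)%N.
  apply: perm_big; apply: uniq_perm.
  - by rewrite filter_uniq ?divisors_uniq.
  - rewrite map_inj_uniq ?filter_uniq ?divisors_uniq // => a b /eqP.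
    by rewrite eqn_pmul2l // => /eqP.
  move=> d; rewrite mem_filter -dvdn_divisors //; apply/idP/mapP.
    case/andP=> /andP[/dvdnP[e ->{d}]]; rewrite mulnC -mulnn.
    rewrite dvdn_pmul2l // => pe dm; exists e => //.
    rewrite mem_filter pe -dvdn_divisors //.
    exact: dvdn_trans (dvdn_mull _ (dvdnn e)) dm.
  case=> e; rewrite mem_filter -dvdn_divisors // => /andP[pe em] ->.
  by rewrite dvdn_mulr // dvdn_pmul2l // pe Gauss_dvd ?pm // prime_coprime.
rewrite big_map -big_split big_seq big1 //= => e.
rewrite mem_filter -dvdn_divisors // => /andP[pe em].
rewrite moebius_prime_mul ?(dvdn_gt0 m_gt0) // mulrNz mulNr -fE ?addNr //.
by rewrite Gauss_dvd ?pm // prime_coprime.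
Qed.

Lemma horner_necklace (F : numFieldType) (m : nat) (z : F) :
  (necklace F m).[z] =
  m%:R^-1 * \sum_(d <- divisors m) (moebius d)%:~R * z ^+ (m %/ d).
Proof.
rewrite hornerZ horner_sum; congr (_ * _).
by apply: eq_bigr => d _; rewrite hornerZ hornerXn.
Qed.

Lemma necklace1_N1 (F : numFieldType) : (necklace F 1).[-1] = -1.
Proof. by rewrite horner_necklace big_seq1 /= invr1 !mul1r. Qed.

Lemma necklace2_N1 (F : numFieldType) : (necklace F 2).[-1] = 1.
Proof.
rewrite horner_necklace (_ : divisors 2 = [:: 1; 2]%N) // big_cons big_seq1 /=.
rewrite /moebius /= expr0 !expr1 sqrrN expr1n mulrNz mulrN mulNr opprK.
by rewrite ?mulr1 mulr1z -mulr2n mulVf // pnatr_eq0.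
Qed.

(** The pairing applies with an odd prime [p], since multiplying by [p] then
    preserves parity, and with [p = 2] if [4 %| m], since both cofactors are then
    even.  Every [m >= 3] falls under one of the two cases. *)
Lemma necklace_N1_eq0 (F : numFieldType) (m : nat) :
  (3 <= m)%N -> (necklace F m).[-1] = 0.
Proof.
move=> m_ge3; have m_gt0 : (0 < m)%N by apply: leq_trans m_ge3.
have [p p_pr] : {p | prime p & (p %| m)%N && (odd p || (4 %| m)%N)}.
  have [q q_pr qm] : {q | prime q & q %| m}%N by apply: pdivP; lia.
  have [q_odd | q_even] := boolP (odd q); first by exists q; rewrite ?qm ?q_odd.
  have q2 : q = 2%N by case: (even_prime q_pr) q_even => // ->.
  have [r r_pr rm2] : {r | prime r & r %| m %/ 2}%N by apply: pdivP; lia.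
  have m2 : m = (m %/ 2 * 2)%N by rewrite q2 in qm; rewrite divnK.
  exists r; rewrite // m2 dvdn_mulr //=.
  case: (even_prime r_pr) rm2 => [-> rm2 | -> //].
  by rewrite (@dvdn_pmul2r 2 2) // rm2 orbT.
case/andP=> pm p_ok; rewrite horner_necklace.
rewrite (@sum_moebius_pairing _ (fun k => (-1) ^+ k) p) ?mulr0 // => k pkm pNk.
case/dvdnP: pkm m_gt0 p_ok => q ->; rewrite !muln_gt0.
case/and3P=> q_gt0 p_gt0 k_gt0.
rewrite mulnK ?muln_gt0 ?p_gt0 // mulnCA mulnA mulnK // => p_ok.
rewrite -[LHS]signr_odd -[RHS]signr_odd oddM.
case: (boolP (odd p)) p_ok pNk => //= p_even; have -> : p = 2%N.
  by case: (even_prime p_pr) p_even => // ->.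
rewrite -mulnA (@dvdn_pmul2l 2 2) // Euclid_dvdM // => /orP[|-> //].
by rewrite dvdn2 => /negPf->.
Qed.

(** * The product of binomials over the parts of a partition *)

Lemma gbinom_nat (F : numFieldType) (m k : nat) :
  gbinom (m%:R : F) k = 'C(m, k)%:R.
Proof.
have fk : (k`!)%:R != 0 :> F by rewrite pnatr_eq0 -lt0n fact_gt0.
apply: (mulIf fk); rewrite /gbinom mulfVK // -natrM bin_ffact.
have [le_km | lt_mk] := leqP k m; last first.
  by rewrite ffact_small // (bigD1 (Ordinal lt_mk)) //= subrr mul0r.
rewrite ffact_prod natr_prod; apply: eq_bigr => i _.
by rewrite natrB // ltnW // (leq_trans (ltn_ord i)).
Qed.

Lemma gbinom_N1 (F : numFieldType) (k : nat) : gbinom (-1 : F) k = (-1) ^+ k.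
Proof.
have fk : (k`!)%:R != 0 :> F by rewrite pnatr_eq0 -lt0n fact_gt0.
apply: (mulIf fk); rewrite /gbinom mulfVK //.
elim: k {fk} => [|k IHk]; first by rewrite big_ord0 mulr1.
rewrite big_ord_recr /= IHk factS exprS natrM -nat1r; ring.
Qed.

Lemma leq_size_sumn (la : seq nat) : 0%N \notin la -> (size la <= sumn la)%N.
Proof.
elim: la => //= k la IHla; rewrite inE negb_or eq_sym -lt0n => /andP[k_gt0 /IHla].
by lia.
Qed.

Lemma sumn_count2 (la : seq nat) : 0%N \notin la ->
    all (fun k => k <= 2)%N la ->
  sumn la = (count_mem 1 la + 2 * count_mem 2 la)%N /\
  size la = (count_mem 1 la + count_mem 2 la)%N.
Proof.
elim: la => [|[|[|[|k]]] la IHla] //=; rewrite inE //= => /IHla{}IHla;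
  case/IHla=> -> ->;
  move: (count_mem 1 la) (count_mem 2 la) => c1 c2; split; lia.
Qed.

(** A part [j >= 3] kills the product because [M_j(-1) = 0], and two parts equal
    to [2] kill it because [M_2(-1) = 1].  Otherwise only the parts [1]
    contribute, each a sign, and their number has the parity of [n].  As the
    excess [n - size la] is the sum of the [k - 1] over the parts [k], these two
    obstructions are absent exactly when [n <= (size la).+1]. *)
Lemma prod_gbinom_necklace_N1 (F : numFieldType) (n : nat) (la : seq nat) :
    0%N \notin la -> sumn la = n ->
  \prod_(1 <= j < n.+1) gbinom (necklace F j).[-1] (count_mem j la) =
  (-1) ^+ n * (n <= (size la).+1)%:R.
Proof.
move=> la_pos sum_la.
have [/hasP[k k_la k_gt2] | ] := boolP (has (leq 3) la).
  have [le_kn lt_sn] : (k <= n /\ (size la).+1 < n)%N.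
    have eq_la := perm_to_rem k_la.
    rewrite -sum_la (perm_sumn eq_la) (perm_size eq_la) /=.
    have /leq_size_sumn : 0%N \notin rem k la by apply: contra la_pos => /mem_rem.
    by lia.
  rewrite leqNgt lt_sn mulr0.
  rewrite (bigD1_seq k) ?iota_uniq ?mem_index_iota ?ltnS ?le_kn ?andbT //=;
    last exact: leq_trans k_gt2.
  rewrite necklace_N1_eq0 // (gbinom_nat F 0) bin0n -leqn0 leqNgt.
  by rewrite -has_count has_pred1 k_la mul0r.
move=> /hasPn la_lt3.
have la_le2 : all (fun k => k <= 2)%N la.
  by apply/allP => k /la_lt3; rewrite -ltnNge.
have [sumE sizeE] := sumn_count2 la_pos la_le2; rewrite sum_la in sumE.
have [c1 c1E] : {c | count_mem 1 la = c} by eexists.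
have [c2 c2E] : {c | count_mem 2 la = c} by eexists.
rewrite c1E c2E in sumE sizeE.
have count_gt2 j : (3 <= j)%N -> count_mem j la = 0%N.
  by move=> j3; apply/count_memPn/negP => /(allP la_le2); lia.
have gbinom_gt2 j :
    (3 <= j)%N -> gbinom (necklace F j).[-1] (count_mem j la) = 1.
  by move=> j3; rewrite count_gt2 // /gbinom big_ord0 divr1.
have -> : (n <= (size la).+1)%N = 'C(1, c2) :> nat.
  by case: c2 sumE sizeE {c2E} => [|[|c]] sumE sizeE;
    rewrite ?bin0 ?bin1 ?bin_small //; lia.
have -> : (-1) ^+ n = (-1) ^+ c1 :> F.
  by rewrite -signr_odd sumE oddD oddM addbF signr_odd.
(* For n <= 1 the index range does not contain 2. *)
have [n_le1 | n_ge2] := leqP n 1.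
  have -> : c2 = 0%N by lia.
  have [n0 | n1] : n = 0%N \/ n = 1%N by lia.
    have -> : c1 = 0%N by lia.
    by rewrite n0 big_geq // mulr1.
  by rewrite n1 big_nat1 necklace1_N1 gbinom_N1 c1E mulr1.
rewrite big_ltn ?ltnS ?(ltnW n_ge2) // big_ltn ?ltnS //.
rewrite necklace1_N1 gbinom_N1 necklace2_N1 (gbinom_nat F 1) c1E c2E.
rewrite big_nat_cond big1 ?mulr1 // => j /andP[/andP[j_gt2 _] _].
exact: gbinom_gt2.
Qed.

(** * Permutations with at least n - 1 cycles *)

Section Permutations.

Variable T : finType.
Implicit Types (s : {perm T}) (x y : T).

Lemma porbitJ s t x : porbit (s ^ t) (t x) = t @: porbit s x.
Proof.
apply/setP => y; apply/porbitP/imsetP.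
  case=> i ->; exists ((s ^+ i)%g x); rewrite ?mem_porbit //.
  by rewrite -conjXg permJ.
by case=> _ /porbitP[i ->] ->; exists i; rewrite -conjXg permJ.
Qed.

Lemma porbitsJ s t : porbits (s ^ t) = [set t @: c | c : {set T} in porbits s].
Proof.
apply/setP => c; apply/imsetP/imsetP.
  case=> x _ ->; exists (porbit s (t^-1%g x)); first by rewrite imset_f.
  by rewrite -porbitJ permKV.
by case=> _ /imsetP[x _ ->] ->; exists (t x); rewrite ?porbitJ.
Qed.

Lemma card_porbitsJ s t : #|porbits (s ^ t)| = #|porbits s|.
Proof. by rewrite porbitsJ card_imset //; apply/imset_inj/perm_inj. Qed.

Lemma sum_card_porbits s : (\sum_(c in porbits s) #|c| = #|T|)%N.
Proof.
have := @acts_sum_card_orbit _ _ _ (perm_action T) <[s]> [set: T].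
rewrite cardsT => <-; last by apply/actsP => ? _ ?; rewrite !inE.
rewrite /porbits; apply: congr_big => //= c.
by apply/imsetP/imsetP => -[x _ ->]; exists x; rewrite ?inE // porbitE.
Qed.

Lemma card_porbits1 : #|porbits (1 : {perm T})| = #|T|.
Proof.
rewrite card_imset // => x y /eqP; rewrite eq_porbit_mem.
by case/porbitP => i ->; rewrite expg1n perm1.
Qed.

Lemma card_porbits_max s : (#|T| <= #|porbits s|)%N -> s = 1%g.
Proof.
move=> leT; have /imset_injP inj_s : #|porbits s| == #|T|.
  by rewrite eqn_leq leT leq_imset_card.
apply/permP => x; rewrite perm1; apply: inj_s => //; apply/eqP.
by rewrite eq_porbit_mem (mem_porbit s 1).
Qed.

Lemma card_porbits_tperm x y : x != y -> (#|porbits (tperm x y)|.+1 = #|T|)%N.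
Proof.
move=> ne_xy; have /= := porbits_mul_tperm 1 x y.
rewrite mulg1 card_porbits1 ne_xy.
have -> : x \notin porbit (1 : {perm T}) y.
  by apply: contra ne_xy => /porbitP[i ->]; rewrite expg1n perm1.
by rewrite /=; lia.
Qed.

Variant identity_or_tperm_spec s : Prop :=
  | IsIdentity of s = 1%g
  | IsTperm x y of x != y & s = tperm x y.

(** If [s] moves [x], then [x] and [s x] lie on one cycle, and multiplying [s] by
    the transposition of these two points splits that cycle.  The product then
    has at least [#|T|] cycles, so it is the identity. *)
Lemma identity_or_tpermP s :
  (#|T| <= #|porbits s|.+1)%N -> identity_or_tperm_spec s.
Proof.
move=> leT; have [x sx | s_id] := pickP (fun x => s x != x); last first.
  by left; apply/permP => x; rewrite perm1; apply/eqP/negbFE/s_id.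
apply: (@IsTperm _ x (s x)); first by rewrite eq_sym.
have /= := porbits_mul_tperm s x (s x).
rewrite porbit_sym (mem_porbit s 1) eq_sym sx addn0 addn1 => card_ts.
have leT' : (#|T| <= #|porbits (tperm x (s x) * s)|)%N by rewrite card_ts.
have /(canRL (mulKg _)) {1}-> := card_porbits_max leT'.
by rewrite mulg1 tpermV.
Qed.

Lemma tperm_conj a b x y : a != b -> x != y ->
  exists s : {perm T}, (tperm a b ^ s)%g = tperm x y.
Proof.
move=> ne_ab ne_xy; exists (tperm a x * tperm (tperm a x b) y)%g.
rewrite tpermJ !permM (tpermL a x) tpermL tpermD 1?eq_sym //.
by apply: contraNneq ne_ab => /esym/(canRL (tpermK a x)); rewrite tpermR => ->.
Qed.

Lemma order_tperm x y : x != y -> #[tperm x y]%g = 2%N.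
Proof.
move=> ne_xy; apply: nt_prime_order; rewrite // ?expgS ?mulg1 ?tperm2 //.
by apply: contraNneq ne_xy => /permP/(_ x); rewrite tpermL perm1 => ->.
Qed.

(** The two elements of the subgroup have different numbers of cycles, hence are
    not conjugate, and each of them is a representative of one of the two classes
    with at least [#|T| - 1] cycles. *)
Lemma card_cycle_tperm_class a b s : a != b ->
  #|(<[tperm a b]> :&: s ^: [set: {perm T}])%g| = (#|T| <= #|porbits s|.+1)%N.
Proof.
move=> ne_ab.
rewrite (cycle2g (order_tperm ne_ab)).
have [ | gt_T] := boolP (_ <= _)%N.
  case/identity_or_tpermP => [-> | x y ne_xy ->].
    rewrite class1G (_ : _ :&: _ = [set 1%g]) ?cards1 //.
    by apply/setP => h; rewrite !inE andb_orl andbC; case: eqP.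
  rewrite (_ : _ :&: _ = [set tperm a b]) ?cards1 //.
  apply/setP => h; rewrite !inE; apply/andP/eqP.
    case=> /orP[/eqP-> | /eqP-> //] /imsetP[t _ /esym/eqP].
    rewrite conjg_eq1 => /eqP t1; have := card_porbits_tperm ne_xy.
    by rewrite t1 card_porbits1; lia.
  move=> ->; rewrite eqxx orbT; split=> //; apply/imsetP.
  by have [t <-] := tperm_conj ne_xy ne_ab; exists t; rewrite ?inE.
apply/eqP; rewrite cards_eq0; apply: contraR gt_T => /set0Pn[h].
rewrite !inE => /andP[h_ab /imsetP[t _ h_t]].
rewrite -(card_porbitsJ s t) -h_t.
case/orP: h_ab => /eqP->; first by rewrite card_porbits1.
by rewrite card_porbits_tperm.
Qed.

End Permutations.

(** * Cycle types and conjugacy classes *)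

Lemma cycle_type_perm_eq n (g : 'S_n) :
  perm_eq (cycle_type g) [seq #|pred_of_set c| | c <- enum (porbits g)].
Proof. by rewrite /cycle_type perm_sort. Qed.

Lemma size_cycle_type n (g : 'S_n) : size (cycle_type g) = #|porbits g|.
Proof. by rewrite (perm_size (cycle_type_perm_eq g)) size_map -cardE. Qed.

Lemma sumn_cycle_type n (g : 'S_n) : sumn (cycle_type g) = n.
Proof.
rewrite (perm_sumn (cycle_type_perm_eq g)) sumnE big_map big_enum /=.
by rewrite sum_card_porbits card_ord.
Qed.

Lemma cycle_type_gt0 n (g : 'S_n) : 0%N \notin cycle_type g.
Proof.
rewrite (perm_mem (cycle_type_perm_eq g)); apply/mapP => -[c].
rewrite mem_enum => /imsetP[x _ ->] /esym/eqP.
by rewrite (negPf (card_porbit_neq0 g x)).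
Qed.

Lemma cycle_typeJ n (g s : 'S_n) : cycle_type (g ^ s) = cycle_type g.
Proof.
apply/perm_sortP; [exact: (fun a b => leq_total b a) | | | ].
- by move=> a b c ba ac; apply: leq_trans ac ba.
- by move=> a b; rewrite andbC -eqn_leq => /eqP.
have inj_s : injective (fun c : {set 'I_n} => s @: c).
  exact/imset_inj/perm_inj.
apply: (@perm_trans _ [seq #|s @: c| | c : {set 'I_n} <- enum (porbits g)]);
  last first.
  rewrite (@eq_map _ _ _ (fun c : {set 'I_n} => #|c|)) // => c.
  exact/card_imset/perm_inj.
rewrite (map_comp (fun c : {set 'I_n} => #|c|) (fun c : {set 'I_n} => s @: c)).
apply/perm_map/uniq_perm; rewrite ?map_inj_uniq ?enum_uniq // => c.
rewrite mem_enum porbitsJ; apply/imsetP/mapP => -[d d_g ->]; exists d => //.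
  by rewrite mem_enum.
by rewrite mem_enum in d_g.
Qed.

(** For these permutations the cycle type is determined by the number of cycles,
    and the transpositions form a single conjugacy class. *)
Lemma cycle_class_identity_or_tperm n (g : 'S_n) :
    (n <= #|porbits g|.+1)%N ->
  cycle_class n (cycle_type g) = (g ^: [set: 'S_n])%g.
Proof.
move=> leg; apply/setP => h; rewrite inE; apply/eqP/imsetP; last first.
  by case=> s _ ->; apply: cycle_typeJ.
move=> eq_hg; have eq_card : #|porbits h| = #|porbits g|.
  by rewrite -!size_cycle_type eq_hg.
have := @identity_or_tpermP _ g; rewrite card_ord => /(_ leg).
have := @identity_or_tpermP _ h; rewrite card_ord eq_card => /(_ leg).
case=> [h1 | x y ne_xy ht] [g1 | a b ne_ab gt].
- by exists 1%g; rewrite ?inE // g1 h1 conj1g.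
- by have := card_porbits_tperm ne_ab; rewrite -gt -eq_card h1 card_porbits1; lia.
- by have := card_porbits_tperm ne_xy; rewrite -ht eq_card g1 card_porbits1; lia.
have [s Es] := tperm_conj ne_ab ne_xy.
by exists s; rewrite ?inE // ht gt Es.
Qed.

(** * The permutation representation on right cosets *)

Section CosetRepresentation.

Variables (F : fieldType) (gT : finGroupType) (G H : {group gT}).
Hypothesis sHG : H \subset G.

Local Notation N := #|rcosets H G|.

Definition coset_mx (g : gT) : 'M[F]_N :=
  \matrix_(i, j) (enum_val i :* g == enum_val j)%g%:R.

Lemma rcosets_mulr (A : {set gT}) (g : gT) :
  A \in rcosets H G -> g \in G -> (A :* g)%g \in rcosets H G.
Proof.
case/rcosetsP => x Gx -> Gg; apply/rcosetsP; exists (x * g)%g.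
  by rewrite groupM.
by rewrite rcosetM.
Qed.

Lemma enum_val_surj (A : {set gT}) :
  A \in rcosets H G -> {i : 'I_N | enum_val i = A}.
Proof. by move=> HA; exists (enum_rank_in HA A); rewrite enum_rankK_in. Qed.

Lemma coset_mx_repr : mx_repr G coset_mx.
Proof.
split=> [|x y Gx Gy].
  by apply/matrixP => i j; rewrite !mxE mulg1 (inj_eq enum_val_inj).
apply/matrixP => i j; rewrite !mxE.
have [k Ek] := enum_val_surj (rcosets_mulr (enum_valP i) Gx).
rewrite (bigD1 k) //= big1 => [|l ne_lk]; rewrite !mxE -Ek.
  by rewrite eqxx mul1r addr0 Ek -rcosetM.
by rewrite (inj_eq enum_val_inj) eq_sym (negPf ne_lk) mul0r.
Qed.

Definition coset_repr : mx_representation F G N :=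
  MxRepresentation coset_mx_repr.

Lemma coset_repr_is_permutation : is_permutation_repr coset_repr.
Proof.
move=> g Gg; apply/is_perm_mxP.
pose f i := sval (enum_val_surj (rcosets_mulr (enum_valP i) Gg)).
have fE i : enum_val (f i) = (enum_val i :* g)%g.
  by rewrite /f; case: enum_val_surj.
have inj_f : injective f.
  by move=> i j /(congr1 enum_val); rewrite !fE => /rcoset_inj/enum_val_inj.
exists (perm inj_f); apply/matrixP => i j.
by rewrite !mxE permE -fE (inj_eq enum_val_inj).
Qed.

(** The basis vector of the coset [H] spans a line on which [H] acts trivially,
    and its translate by a representative of a coset is the basis vector of that
    coset.  So the translates are the coordinate lines, whose sum is direct and
    full. *)
Lemma coset_repr_is_induced : is_induced_repr coset_repr (triv_repr F H).
Proof.
split=> //.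
have HH : (H : {set gT}) \in rcosets H G.
  by apply/rcosetsP; exists 1%g; rewrite ?rcoset1.
have [i0 Ei0] := enum_val_surj HH.
pose W : 'rV[F]_N := delta_mx 0 i0.
have translate (A : {set gT}) i : enum_val i = A ->
    W *m coset_repr (repr A) = delta_mx 0 i :> 'rV[F]_N.
  move=> EA; have HA : A \in rcosets H G by rewrite -EA enum_valP.
  apply/rowP => j; rewrite /W -rowE !mxE Ei0 eqxx /=.
  case/rcosetsP: HA EA => x _ -> Ei.
  by rewrite rcoset_repr -Ei (inj_eq enum_val_inj) eq_sym.
have full : row_full (\sum_(A in rcosets H G)
    <<W *m coset_repr (repr A)>>)%MS.
  rewrite -sub1mx; apply/row_subP => i; rewrite row1.
  rewrite (sumsmx_sup (enum_val i)) ?enum_valP //.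
  by rewrite (translate _ i) // genmxE.
exists W; split=> //.
- by rewrite /row_free mxrank_delta.
- move=> h Hh; rewrite mul1mx; apply/rowP => j; rewrite /W -rowE !mxE Ei0 eqxx /=.
  by rewrite rcoset_id // -[X in X == _]Ei0 (inj_eq enum_val_inj) eq_sym.
(* Both the rank of the sum and the sum of the ranks are the index of H. *)
rewrite mxdirectE /=; move/eqnP: full => ->.
rewrite -[X in X == _]sum1_card; apply/eqP/eq_bigr => A HA.
have [i Ei] := enum_val_surj HA.
by rewrite (translate _ _ Ei) mxrank_gen mxrank_delta.
Qed.

Lemma mxtrace_coset_repr g :
  \tr (coset_repr g) = #|[set A in rcosets H G | (A :* g)%g == A]|%:R.
Proof.
rewrite /mxtrace -[in RHS]sum1_card natr_sum.
rewrite (eq_bigr (fun i => ((enum_val i :* g)%g == enum_val i)%:R)); last first.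
  by move=> i _; rewrite mxE.
rewrite -(big_enum_val (fun A : {set gT} => ((A :* g)%g == A)%:R : F)) /=.
rewrite [LHS]big_mkcond [RHS]big_mkcond; apply: eq_bigr => A _; rewrite inE.
by case: (A \in _); case: eqP.
Qed.

(** The coset [H x] is fixed by [g] if and only if [x g x^-1] is in [H], a
    condition that all [#|H|] elements of the coset share. *)
Lemma card_fixed_rcosets g :
  (#|H| * #|[set A in rcosets H G | (A :* g)%g == A]|)%N =
  #|[set x in G | (g ^ x^-1)%g \in H]|.
Proof.
have fixedE x : (g ^ x^-1 \in H)%g = (H :* x :* g == H :* x)%g.
  by rewrite -rcosetM (sameP eqP rcoset_eqP) mem_rcoset conjgE invgK mulgA.
rewrite -[RHS]sum1_card.
rewrite (eq_bigl (fun x => (x \in G) && (H :* x :* g == H :* x)%g));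
  last by move=> x /=; rewrite inE fixedE.
rewrite big_mkcondr /= (set_partition_big _ (rcosets_partition sHG)) /=.
rewrite -[#|[set A in _ | _]|]sum1_card.
rewrite (eq_bigl (fun A => (A \in rcosets H G) && (A :* g == A)%g));
  last by move=> A /=; rewrite inE.
rewrite big_mkcondr big_distrr /=; apply: eq_bigr => _ /rcosetsP[x _ ->].
rewrite -(card_rcoset H x) -sum_nat_const; apply: eq_bigr => y.
by move=> /rcoset_eqP->.
Qed.

(** Both sides count the pairs of [x] in [G] and [y] in [g ^: G] with [x y x^-1]
    in [H].  For fixed [y] the number of [x] depends only on the class of [y]; for fixed
    [x] the [y] range over the intersection of the class with a conjugate of
    [H]. *)
Lemma card_class_fixed g : g \in G ->
  (#|[set x in G | (g ^ x^-1)%g \in H]| * #|(g ^: G)%g|)%N =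
  (#|G| * #|(H :&: g ^: G)%g|)%N.
Proof.
move=> Gg.
have card_conj y : y \in (g ^: G)%g ->
    #|[set x in G | (y ^ x^-1)%g \in H]| = #|[set x in G | (g ^ x^-1)%g \in H]|.
  case/imsetP=> z Gz ->.
  rewrite -(card_rcoset [set x in G | (g ^ x^-1)%g \in H] z).
  apply: eq_card => x; rewrite mem_rcoset !inE invMg invgK conjgM.
  by rewrite (groupMr _ (groupVr Gz)).
transitivity (\sum_(y in (g ^: G)%g) #|[set x in G | (y ^ x^-1)%g \in H]|)%N.
  rewrite (eq_bigr (fun=> #|[set x in G | (g ^ x^-1)%g \in H]|)) //.
  by rewrite sum_nat_const mulnC.
under eq_bigr do rewrite -sum1_card big_mkcond /=.
rewrite exchange_big /= (bigID (mem G)) /=.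
rewrite [X in (_ + X)%N]big1 ?addn0; last first.
  by move=> x Gx; rewrite big1 // => y _; rewrite inE (negPf Gx).
rewrite -sum_nat_const; apply: eq_bigr => x Gx.
rewrite -big_mkcondr sum1_card -(cardJg _ x) conjIg.
rewrite (normsP (class_norm g G)) //; apply: eq_card => y.
by rewrite !inE mem_conjg unfold_in inE Gx andbC.
Qed.

(** The character formula for the induction of a trivial representation, freed of
    divisions so that it holds over any field. *)
Lemma mxtrace_coset_repr_class g : g \in G ->
  (#|H| * #|(g ^: G)%g|)%N%:R * \tr (coset_repr g) =
  (#|G| * #|(H :&: g ^: G)%g|)%N%:R :> F.
Proof.
move=> Gg; rewrite mxtrace_coset_repr -natrM mulnAC card_fixed_rcosets.
by rewrite card_class_fixed.
Qed.

End CosetRepresentation.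

(** * The (-1)-splitting measure as an induced character *)

(** At [z = -1] the prefactor [1 / (z^(n-1) (z - 1))] is [(-1)^n / 2], whose sign
    cancels the one of the product of binomials. *)
Lemma splitting_measure_N1 (F : numFieldType) (n : nat) (g : 'S_n) :
    (0 < n)%N ->
  splitting_measure (-1 : F) g =
  (n <= #|porbits g|.+1)%:R / (2 * #|cycle_class n (cycle_type g)|%:R).
Proof.
move=> n_gt0; rewrite /splitting_measure /splitting_measure_class.
rewrite (prod_gbinom_necklace_N1 F (cycle_type_gt0 g) (sumn_cycle_type g)).
rewrite size_cycle_type; set b : F := (_ <= _)%:R.
have -> : (-1) ^+ n.-1 * (-1 - 1) = (-1) ^+ n * 2 :> F.
  by rewrite -[in RHS](prednK n_gt0) exprS; ring.
rewrite invfM mulrACA mulVf ?signr_eq0 // mul1r invfM mulrA.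
by rewrite [_ * b]mulrC.
Qed.

Theorem theorem6p2 (R : realType) (n : nat) (hn : (2 <= n)%N) :
  exists (N : nat) (rho : mx_representation R[i] [set: 'S_n]%G N),
    [/\ forall g : 'S_n,
          \tr (rho g) = (n`!)%:R * splitting_measure (-1 : R[i]) g,
        is_permutation_repr rho &
        is_induced_repr rho (triv_repr R[i] (transp_group hn))].
Proof.
have sHG : transp_group hn \subset [set: 'S_n]%G by apply: subsetT.
exists _, (coset_repr R[i] [set: 'S_n]%G (transp_group hn)); split; last first.
- exact: coset_repr_is_induced.
- exact: coset_repr_is_permutation.
move=> g; have ne01 : Ordinal (ltnW hn) != Ordinal hn by [].
have := mxtrace_coset_repr_class R[i] sHG (in_setT g).
rewrite /= card_cycle_tperm_class // -orderE order_tperm // card_ord.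
rewrite cardsT card_Sn splitting_measure_N1 ?(ltnW hn) //.
have class_neq0 : (2 * #|(g ^: [set: 'S_n])%g|)%N%:R != 0 :> R[i].
  rewrite pnatr_eq0 muln_eq0 /= cards_eq0; apply/set0Pn; exists g.
  exact: class_refl.
(* When the number of cycles is less than n - 1, both sides vanish. *)
have [le_ng | _] := leqP n _; last first.
  move/eqP; rewrite muln0 mulf_eq0 (negPf class_neq0) /= mul0r mulr0.
  by move/eqP.
rewrite cycle_class_identity_or_tperm // muln1 mul1r -natrM => tr_eq.
by apply: (mulfI class_neq0); rewrite tr_eq mulrC mulfVK.
Qed.
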